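(* $\mathrm{WMM} \subseteq \mathrm{OOO}^{VP}{+}\mathrm{CCM}$; that is, for every number of processors $n$, every $n$-processor program and every initial state, every program behavior of the memory model $\mathrm{WMM}$ is also a program behavior of the physical multiprocessor model $\mathrm{OOO}^{VP}{+}\mathrm{CCM}$.
   Context: **Programs and conventions.** There are $n$ processors. Processor $i$ runs a fixed program: $\mathsf{fetch}(pc)$ gives the instruction at $pc$ (never modified). Instructions are: $\mathsf{Nm}$ (non-memory, e.g. ALU/branch: from its source registers and its PC it computes a next PC and a value for a destination register), $\mathsf{Ld}$ (an address is computed from source registers, the loaded value goes to a destination register), $\mathsf{St}$ (address and data are computed from source registers), and the fences $\mathsf{Commit}$ and $\mathsf{Reconcile}$. The next PC of a non-$\mathsf{Nm}$ instruction is determined by its PC alone. Each model is a nondeterministic transition system; a rule may fire atomically whenever its guard holds; an execution is a finite sequence of rule firings from the initial state. All models start with the same registers, PCs and memory values, with all buffers empty. $\epsilon$ means ''not available''. **CCM (write-back cache memory).** State: memory $m$ with $m[a]=\langle v,t\rangle$ (value and tag of the store that wrote it; initial values carry special tags different from the tags of all stores), and for each $i$ an unordered buffer $mrb[i]$. Processor $i$ calls $\mathsf{reqLd}(idx,a)$ or $\mathsf{reqSt}(a,v,t)$, which insert $\langle \mathsf{Ld},idx,a\rangle$ or $\langle\mathsf{St},a,v,t\rangle$ into $mrb[i]$. Rules: *CCM-Ld*: remove any $\langle\mathsf{Ld},idx,a\rangle$ from some $mrb[i]$ and call $\mathsf{respLd}(idx,v,t)$ of processor $i$, where $\langle v,t\rangle=m[a]$.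 *CCM-St*: remove any $\langle\mathsf{St},a,v,t\rangle$ from some $mrb[i]$, set $m[a]:=\langle v,t\rangle$, call $\mathsf{respSt}(a)$ of processor $i$. **$\mathrm{OOO}^{VP}$ (out-of-order processor).** State of each processor: PC register $pcr$, register file $rf$, reorder buffer $rob$, store buffer $sb$ (a list of entries $\langle a,v,t,iss\rangle$ ordered from oldest to youngest), and a bit vector $lf$ (initially all False). $rob$ is a list of unbounded length; each new entry gets an index larger than all indices ever used (younger = larger index; indices are never reused). An entry is $\langle pc,npc,ins,ex\rangle$ with $npc$ the (predicted) next PC and $ex\in\{\mathsf{Idle},\mathsf{Exe},\mathsf{ReEx},\mathsf{Done}\}$. The field $ins$ is $\langle\mathsf{Nm},op,srcs,dst,val\rangle$, or $\langle\mathsf{Ld},srcs,dst,a,v,t\rangle$ ($t$ = tag of the store read), or $\langle\mathsf{St},srcs,a,v,t\rangle$ ($t$ = globally unique tag assigned at fetch), or $\langle\mathsf{Commit}\rangle$, or $\langle\mathsf{Reconcile}\rangle$; the fields $val,a,v$ and the tag of a load are initially $\epsilon$. A source register of an entry is ready if the youngest older $rob$ entry writing that register has a non-$\epsilon$ value (possibly a predicted load value), or if no older entry writes it (then $rf$ is used); an entry is ready if all its source registers are. The commit slot is the oldest entry. Auxiliary operations. $\mathsf{flush}(idx,pc)$: delete all entries with index $\ge idx$, set $pcr:=pc$, and for each deleted $\mathsf{Ld}$ with $ex\in\{\mathsf{Exe},\mathsf{ReEx}\}$ set its $lf$ bit to True. $\mathsf{findBypass}(idx,a)$: search $rob$ from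 the entry just older than $idx$ to the oldest, then $sb$ from youngest to oldest; return $\langle v,t\rangle$ of the first executed store to $a$ found; return $\epsilon$ if a $\mathsf{Reconcile}$ is met first; return $\top$ if nothing is found. $\mathsf{findAffectedLd}(idx,a)$: search from index $idx+1$ to the youngest entry, stopping at the first $\mathsf{St}$ with computed address $a$; return the list (oldest first) of all $\mathsf{Ld}$ entries met with address $a$ and $ex\ne\mathsf{Idle}$. $\mathsf{findStaleLd}(idx,a,t)$: search from $idx+1$ to the youngest entry for the first $\mathsf{Ld}$ with address $a$, $ex=\mathsf{Done}$ and tag $t'\neq t$ and return its index; return $\top$ if there is none or if a $\mathsf{St}$ with computed address $a$ is met first. Rules: - *OOO-Fetch*: $ins=\mathsf{fetch}(pcr)$; choose a prediction $npc$ (arbitrary for $\mathsf{Nm}$, the correct next PC otherwise); append $\langle pcr,npc,ins,ex\rangle$ with $ex=\mathsf{Done}$ for fences and $\mathsf{Idle}$ otherwise; $pcr:=npc$. - *OOO-NmEx*: for a ready $\mathsf{Idle}$ $\mathsf{Nm}$ entry $idx$, compute $\langle nextpc,val\rangle$, store $val$, set the entry's next-PC field to $nextpc$ and $ex:=\mathsf{Done}$; if $nextpc$ differs from the old $npc$ then $\mathsf{flush}(idx+1,nextpc)$. - *OOO-LdAddr*: for a ready $\mathsf{Idle}$ $\mathsf{Ld}$ with address $\epsilon$, compute and record its address. - *OOO-LdPred*: for any $\mathsf{Ld}$ entry with $v=\epsilon$ and tag $\epsilon$, set $v$ to an arbitrary predicted value. - *OOO-LdBypass*: for a ready $\mathsf{Idle}$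 $\mathsf{Ld}$ at $idx$ with computed address $a$, current value $v$ and tag $\epsilon$, if $\mathsf{findBypass}(idx,a)=\langle res,t\rangle$ (neither $\epsilon$ nor $\top$): set value $res$, tag $t$, $ex:=\mathsf{Done}$; if $v\neq\epsilon$ and $v\ne res$ then $\mathsf{flush}(idx+1,npc)$. - *OOO-LdReq*: for a ready $\mathsf{Idle}$ $\mathsf{Ld}$ at $idx$ with computed address $a$ and tag $\epsilon$, if $\mathsf{findBypass}(idx,a)=\top$ and $\neg lf[idx]$: call $\mathsf{reqLd}(idx,a)$ and set $ex:=\mathsf{Exe}$. - *OOO-StEx*: for a ready $\mathsf{Idle}$ $\mathsf{St}$ at $idx$, compute address $a$ and data $v$, let $list=\mathsf{findAffectedLd}(idx,a)$, record $a,v$, set $ex:=\mathsf{Done}$; then for each $k$ in $list$ from oldest to youngest: if $rob[k].ex=\mathsf{Done}$ then $\mathsf{flush}(k,rob[k].pc)$ and stop, else $rob[k].ex:=\mathsf{ReEx}$. - *OOO-NmLdRecCom*: if the commit slot is a $\mathsf{Done}$ $\mathsf{Nm}$, $\mathsf{Ld}$ or $\mathsf{Reconcile}$, remove it and update $rf$ with its result. - *OOO-StCom*: if the commit slot is a $\mathsf{Done}$ $\mathsf{St}$, remove it and append $\langle a,v,t,\mathrm{False}\rangle$ to $sb$. - *OOO-ComCom*: if the commit slot is $\mathsf{Commit}$ and $sb$ is empty, remove it. - *OOO-StReq*: for some address $a$ in $sb$ whose oldest store has $iss=$ False, call $\mathsf{reqSt}(a,v,t)$ for that store and set its $iss$ to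 True. Methods called by the memory: $\mathsf{respSt}(a)$ deletes the oldest store to $a$ from $sb$. $\mathsf{respLd}(idx,res,t)$: if $lf[idx]$, set $lf[idx]:=$ False; else, for the $\mathsf{Ld}$ entry at $idx$ (address $a$, current value $v$): if $ex=\mathsf{ReEx}$ set $ex:=\mathsf{Idle}$; otherwise record value $res$, tag $t$, $ex:=\mathsf{Done}$, and then if $v\ne\epsilon$ and $v\neq res$ do $\mathsf{flush}(idx+1,npc)$, else let $k=\mathsf{findStaleLd}(idx,a,t)$ and if $k\ne\top$ do $\mathsf{flush}(k,rob[k].pc)$. $\mathrm{OOO}^{VP}{+}\mathrm{CCM}$ is $n$ such processors connected to the $n$ ports of one CCM. **WMM.** State: monolithic memory $m$ (address to value) and for each processor $i$: register state (including PC), store buffer $sb_i$ (list of $\langle a,v\rangle$, oldest to youngest) and invalidation buffer $ib_i$ (list of $\langle a,v\rangle$ in insertion order). Instructions execute instantaneously in program order; executing one updates registers and PC. Rules for processor $i$, by next instruction: - $\mathsf{Nm}$: execute. - $\mathsf{Ld}\ a$, if $sb_i$ contains $a$: return the youngest value for $a$ in $sb_i$. - $\mathsf{Ld}\ a$, if $sb_i$ does not contain $a$: return $m[a]$ and remove all entries for $a$ from $ib_i$. - $\mathsf{Ld}\ a$, if $sb_i$ does not contain $a$ and $ib_i$ contains $a$: return the value of any entry for $a$ in $ib_i$ and remove all entries for $a$ inserted in $ib_i$ before that entry. - $\mathsf{St}\ a\ v$: append $\langle a,v\rangle$ to $sb_i$ and remove all entries for $a$ from $ib_i$. - $\mathsf{Commit}$: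 executes only if $sb_i$ is empty. - $\mathsf{Reconcile}$: execute and empty $ib_i$. - Background rule (dequeue): for some $a$ in $sb_i$, remove the oldest store $\langle a,v\rangle$ for $a$ from $sb_i$; let $old=m[a]$; set $m[a]:=v$; for every $j\ne i$ such that $sb_j$ does not contain $a$, insert $\langle a,old\rangle$ into $ib_j$. **Program behavior.** Consider any finite execution at whose end all store buffers are empty. Its behavior consists of: for each processor, the sequence of instructions committed from $rob$ (in WMM: executed), with their results ($\mathsf{Nm}$ values and next PCs, store addresses and data, load addresses and loaded values), and the final values in the monolithic memory. $A\subseteq B$ means that every behavior of $A$ is a behavior of $B$, for the same program and initial state. *)

(* Defs.v *)
From mathcomp Require Import all_boot.

Set Implicit Arguments.
Unset Strict Implicit.
Unset Printing Implicit Defensive.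

Section Models.

Variables (Reg Addr Val PC : eqType) (n : nat).

(* The semantics of an instruction is carried by the instruction itself, as
   functions of the values of its source registers (in the order of [srcs]). *)
Inductive instr :=
| INm (op : seq Val -> PC -> PC * Val) (srcs : seq Reg) (dst : Reg)
| ILd (addr : seq Val -> Addr) (srcs : seq Reg) (dst : Reg)
| ISt (addr : seq Val -> Addr) (data : seq Val -> Val) (srcs : seq Reg)
| ICommit
| IReconcile.

(* [succ_pc] gives the next PC of the instructions other than Nm. *)
Record program := Program { fetch : PC -> instr; succ_pc : PC -> PC }.

Record init_state := InitState {
  init_pc : 'I_n -> PC;
  init_rf : 'I_n -> Reg -> Val;
  init_mem : Addr -> Val }.

Inductive result :=
| RNm (npc : PC) (v : Val)
| RLd (a : Addr) (v : Val)
| RSt (a : Addr) (v : Val)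
| RCommit
| RReconcile.

(* One committed (in WMM: executed) instruction.  Since programs are never
   modified, its PC identifies the instruction. *)
Record event := Event { ev_pc : PC; ev_res : result }.

Definition trace := seq ('I_n * event).

(* A rule firing is labelled by the instructions it commits, if any; an
   execution accumulates these labels in chronological order. *)
Inductive execution (S : Type) (step : S -> trace -> S -> Prop) (s0 : S) :
  trace -> S -> Prop :=
| exec_init : execution step s0 [::] s0
| exec_step tr s l s' :
    execution step s0 tr s -> step s l s' -> execution step s0 (tr ++ l) s'.

Definition proc_trace (i : 'I_n) (tr : trace) : seq event :=
  [seq x.2 | x <- tr & x.1 == i].

Record behavior := Behavior {
  beh_instrs : 'I_n -> seq event;
  beh_mem : Addr -> Val }.

Definition has_behavior (S : Type) (step : S -> trace -> S -> Prop) (s0 : S)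
    (sbs_empty : S -> Prop) (mem : S -> Addr -> Val) (b : behavior) : Prop :=
  exists tr s, [/\ execution step s0 tr s,
                   sbs_empty s,
                   forall i, beh_instrs b i = proc_trace i tr &
                   forall a, beh_mem b a = mem s a].

(* Buffers are listed from the oldest to the youngest insertion. *)
Record wproc := WProc {
  wpc : PC;
  wrf : Reg -> Val;
  wsb : seq (Addr * Val);
  wib : seq (Addr * Val) }.

Definition has_addr (a : Addr) (buf : seq (Addr * Val)) : bool :=
  a \in unzip1 buf.

Definition drop_addr (a : Addr) (buf : seq (Addr * Val)) : seq (Addr * Val) :=
  [seq x <- buf | x.1 != a].

(* Instantaneous execution of one instruction under the memory [m], which it
   does not modify. *)
Inductive wmm_exec (pg : program) (m : Addr -> Val) :
  wproc -> event -> wproc -> Prop :=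
| WMM_Nm pc rf sb ib op srcs dst npc v :
    fetch pg pc = INm op srcs dst ->
    op [seq rf r | r <- srcs] pc = (npc, v) ->
    wmm_exec pg m (WProc pc rf sb ib) (Event pc (RNm npc v))
      (WProc npc [eta rf with dst |-> v] sb ib)
| WMM_LdSb pc rf sb ib addr srcs dst a v old young :
    fetch pg pc = ILd addr srcs dst ->
    addr [seq rf r | r <- srcs] = a ->
    sb = old ++ (a, v) :: young ->
    ~~ has_addr a young ->
    wmm_exec pg m (WProc pc rf sb ib) (Event pc (RLd a v))
      (WProc (succ_pc pg pc) [eta rf with dst |-> v] sb ib)
| WMM_LdMem pc rf sb ib addr srcs dst a :
    fetch pg pc = ILd addr srcs dst ->
    addr [seq rf r | r <- srcs] = a ->
    ~~ has_addr a sb ->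
    wmm_exec pg m (WProc pc rf sb ib) (Event pc (RLd a (m a)))
      (WProc (succ_pc pg pc) [eta rf with dst |-> m a] sb (drop_addr a ib))
| WMM_LdIb pc rf sb ib addr srcs dst a v old young :
    fetch pg pc = ILd addr srcs dst ->
    addr [seq rf r | r <- srcs] = a ->
    ~~ has_addr a sb ->
    ib = old ++ (a, v) :: young ->
    wmm_exec pg m (WProc pc rf sb ib) (Event pc (RLd a v))
      (WProc (succ_pc pg pc) [eta rf with dst |-> v] sb
             (drop_addr a old ++ (a, v) :: young))
| WMM_St pc rf sb ib addr data srcs a v :
    fetch pg pc = ISt addr data srcs ->
    addr [seq rf r | r <- srcs] = a ->
    data [seq rf r | r <- srcs] = v ->
    wmm_exec pg m (WProc pc rf sb ib) (Event pc (RSt a v))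
      (WProc (succ_pc pg pc) rf (rcons sb (a, v)) (drop_addr a ib))
| WMM_Commit pc rf ib :
    fetch pg pc = ICommit ->
    wmm_exec pg m (WProc pc rf [::] ib) (Event pc RCommit)
      (WProc (succ_pc pg pc) rf [::] ib)
| WMM_Reconcile pc rf sb ib :
    fetch pg pc = IReconcile ->
    wmm_exec pg m (WProc pc rf sb ib) (Event pc RReconcile)
      (WProc (succ_pc pg pc) rf sb [::]).

Record wmm_state := WmmState {
  wmem : Addr -> Val;
  wprocs : 'I_n -> wproc }.

(* Effect on another processor of overwriting the value [old] of [a]. *)
Definition wmm_invalidate (a : Addr) (old : Val) (q : wproc) : wproc :=
  if has_addr a (wsb q) then q
  else WProc (wpc q) (wrf q) (wsb q) (rcons (wib q) (a, old)).

Inductive wmm_step (prog : 'I_n -> program) :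
  wmm_state -> trace -> wmm_state -> Prop :=
| WMM_Exec m ps i ev p' :
    wmm_exec (prog i) m (ps i) ev p' ->
    wmm_step prog (WmmState m ps) [:: (i, ev)]
      (WmmState m [eta ps with i |-> p'])
| WMM_DeqSb m ps i pc rf ib a v old young :
    ps i = WProc pc rf (old ++ (a, v) :: young) ib ->
    ~~ has_addr a old ->
    wmm_step prog (WmmState m ps) [::]
      (WmmState [eta m with a |-> v]
        (fun j => if j == i then WProc pc rf (old ++ young) ib
                  else wmm_invalidate a (m a) (ps j))).

Definition wmm_init (s0 : init_state) : wmm_state :=
  WmmState (init_mem s0)
    (fun i => WProc (init_pc s0 i) (init_rf s0 i) [::] [::]).

Definition wmm_behavior (prog : 'I_n -> program) (s0 : init_state) :
    behavior -> Prop :=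
  has_behavior (wmm_step prog) (wmm_init s0)
    (fun s => forall i, wsb (wprocs s i) = [::]) wmem.

(* [inl a] tags the initial value of [a]; a store fetched by processor [i] at
   reorder buffer index [k] gets the tag [inr (i, k)], which is globally unique
   because indices are never reused. *)
Definition tag : eqType := (Addr + 'I_n * nat)%type.

Inductive exst := Idle | Exe | ReEx | Done.

(* [None] stands for a value that is not available. *)
Inductive rob_ins :=
| Nm (op : seq Val -> PC -> PC * Val) (srcs : seq Reg) (dst : Reg)
     (val : option Val)
| Ld (addr : seq Val -> Addr) (srcs : seq Reg) (dst : Reg)
     (a : option Addr) (v : option Val) (t : option tag)
| St (addr : seq Val -> Addr) (data : seq Val -> Val) (srcs : seq Reg)
     (a : option Addr) (v : option Val) (t : tag)
| Commit
| Reconcile.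

Record entry := Entry {
  e_idx : nat;
  e_pc : PC;
  e_npc : PC;
  e_ins : rob_ins;
  e_ex : exst }.

Record sb_entry := SbEntry {
  sb_addr : Addr;
  sb_val : Val;
  sb_tag : tag;
  sb_iss : bool }.

(* [rob] and [sb] are listed from oldest to youngest; [nidx] is the index of
   the next fetched entry, hence above every index used so far. *)
Record oproc := OProc {
  pcr : PC;
  rf : Reg -> Val;
  rob : seq entry;
  sb : seq sb_entry;
  lf : nat -> bool;
  nidx : nat }.

Definition set_rf (p : oproc) x := OProc (pcr p) x (rob p) (sb p) (lf p) (nidx p).
Definition set_rob (p : oproc) x := OProc (pcr p) (rf p) x (sb p) (lf p) (nidx p).
Definition set_sb (p : oproc) x := OProc (pcr p) (rf p) (rob p) x (lf p) (nidx p).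
Definition set_lf (p : oproc) x := OProc (pcr p) (rf p) (rob p) (sb p) x (nidx p).

Definition is_done (e : entry) : bool := if e_ex e is Done then true else false.

Definition is_idle (e : entry) : bool := if e_ex e is Idle then true else false.

Definition is_reconcile (e : entry) : bool :=
  if e_ins e is Reconcile then true else false.

Definition is_ld_to (a : Addr) (e : entry) : bool :=
  if e_ins e is Ld _ _ _ (Some a') _ _ then a' == a else false.

Definition is_st_to (a : Addr) (e : entry) : bool :=
  if e_ins e is St _ _ _ (Some a') _ _ then a' == a else false.

Definition is_pending_ld (e : entry) : bool :=
  match e_ins e, e_ex e with
  | Ld _ _ _ _ _ _, Exe | Ld _ _ _ _ _ _, ReEx => true
  | _, _ => false
  end.

(* Value of the register [r] after the entries [old] (oldest first), [None] if
   the youngest of them writing [r] has no value yet. *)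
Definition src_val (rf : Reg -> Val) (old : seq entry) (r : Reg) : option Val :=
  foldl (fun acc e =>
           match e_ins e with
           | Nm _ _ dst v | Ld _ _ dst _ v _ => if dst == r then v else acc
           | _ => acc
           end) (Some (rf r)) old.

(* An entry with older entries [old] is ready when this is not [None]. *)
Definition src_vals (rf : Reg -> Val) (old : seq entry) (srcs : seq Reg) :
    option (seq Val) :=
  let vs := [seq src_val rf old r | r <- srcs] in
  if all isSome vs then Some (pmap id vs) else None.

Definition flush (k : nat) (pc : PC) (p : oproc) : oproc :=
  OProc pc (rf p) [seq e <- rob p | e_idx e < k] (sb p)
    (fun j => lf p j ||
       has (fun e => [&& e_idx e == j, k <= e_idx e & is_pending_ld e]) (rob p))
    (nidx p).

Inductive bypass :=
| BypassStall   (* a Reconcile is met first *)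
| BypassNone
| BypassHit (v : Val) (t : tag).

Fixpoint bypass_sb (a : Addr) (s : seq sb_entry) : bypass :=
  if s is x :: s' then
    if sb_addr x == a then BypassHit (sb_val x) (sb_tag x) else bypass_sb a s'
  else BypassNone.

Fixpoint bypass_rob (a : Addr) (es : seq entry) (s : seq sb_entry) : bypass :=
  match es with
  | [::] => bypass_sb a s
  | e :: es' =>
    match e_ins e, e_ex e with
    | Reconcile, _ => BypassStall
    | St _ _ _ (Some a') (Some v) t, Done =>
      if a' == a then BypassHit v t else bypass_rob a es' s
    | _, _ => bypass_rob a es' s
    end
  end.

(* [old] are the entries older than the load, oldest first. *)
Definition find_bypass (a : Addr) (old : seq entry) (s : seq sb_entry) : bypass :=
  bypass_rob a (rev old) (rev s).

(* In the next two searches [young] are the entries younger than the given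
   index, oldest first; entries are returned rather than their indices. *)
Fixpoint find_affected_ld (a : Addr) (young : seq entry) : seq entry :=
  if young is e :: es then
    if is_st_to a e then [::]
    else if is_ld_to a e && ~~ is_idle e then e :: find_affected_ld a es
    else find_affected_ld a es
  else [::].

Definition has_tag (t : tag) (e : entry) : bool :=
  if e_ins e is Ld _ _ _ _ _ (Some t') then t' == t else false.

Fixpoint find_stale_ld (a : Addr) (t : tag) (young : seq entry) : option entry :=
  if young is e :: es then
    if is_st_to a e then None
    else if [&& is_ld_to a e, is_done e & ~~ has_tag t e] then Some e
    else find_stale_ld a t es
  else None.

Definition mark_reex (k : nat) (es : seq entry) : seq entry :=
  [seq if e_idx e == k then Entry (e_idx e) (e_pc e) (e_npc e) (e_ins e) ReEx
       else e | e <- es].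

Fixpoint redo_lds (es : seq entry) (p : oproc) : oproc :=
  if es is e :: es' then
    if is_done e then flush (e_idx e) (e_pc e) p
    else redo_lds es' (set_rob p (mark_reex (e_idx e) (rob p)))
  else p.

Inductive request :=
| ReqLd (k : nat) (a : Addr)
| ReqSt (a : Addr) (v : Val) (t : tag).

(* [fresh_ins ins t] is the entry content of the fetched instruction [ins],
   where [t] is the tag it gets in case it is a store. *)
Definition fresh_ins (ins : instr) (t : tag) : rob_ins :=
  match ins with
  | INm op srcs dst => Nm op srcs dst None
  | ILd addr srcs dst => Ld addr srcs dst None None None
  | ISt addr data srcs => St addr data srcs None None t
  | ICommit => Commit
  | IReconcile => Reconcile
  end.

Definition fresh_ex (ins : instr) : exst :=
  match ins with ICommit | IReconcile => Done | _ => Idle end.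

Definition is_nm (ins : instr) : bool :=
  if ins is INm _ _ _ then true else false.

(* [ooo_rule pg i p rq evs p']: processor [i] moves from [p] to [p'], sending
   the requests [rq] to its memory port and committing [evs]. *)
Inductive ooo_rule (pg : program) (i : 'I_n) (p : oproc) :
  seq request -> seq event -> oproc -> Prop :=
| OOO_Fetch ins npc :
    fetch pg (pcr p) = ins ->
    (~~ is_nm ins -> npc = succ_pc pg (pcr p)) ->
    ooo_rule pg i p [::] [::]
      (OProc npc (rf p)
         (rcons (rob p)
            (Entry (nidx p) (pcr p) npc (fresh_ins ins (inr (i, nidx p)))
                   (fresh_ex ins)))
         (sb p) (lf p) (nidx p).+1)
| OOO_NmEx old young k pc npc op srcs dst val0 vs nextpc val p1 :
    rob p = old ++ Entry k pc npc (Nm op srcs dst val0) Idle :: young ->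
    src_vals (rf p) old srcs = Some vs ->
    op vs pc = (nextpc, val) ->
    p1 = set_rob p
      (old ++ Entry k pc nextpc (Nm op srcs dst (Some val)) Done :: young) ->
    ooo_rule pg i p [::] [::]
      (if nextpc != npc then flush k.+1 nextpc p1 else p1)
| OOO_LdAddr old young k pc npc addr srcs dst v t vs :
    rob p = old ++ Entry k pc npc (Ld addr srcs dst None v t) Idle :: young ->
    src_vals (rf p) old srcs = Some vs ->
    ooo_rule pg i p [::] [::]
      (set_rob p (old ++
         Entry k pc npc (Ld addr srcs dst (Some (addr vs)) v t) Idle :: young))
| OOO_LdPred old young k pc npc addr srcs dst a ex v :
    rob p = old ++ Entry k pc npc (Ld addr srcs dst a None None) ex :: young ->
    ooo_rule pg i p [::] [::]
      (set_rob p (old ++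
         Entry k pc npc (Ld addr srcs dst a (Some v) None) ex :: young))
| OOO_LdBypass old young k pc npc addr srcs dst a v vs res t p1 :
    rob p = old ++ Entry k pc npc (Ld addr srcs dst (Some a) v None) Idle :: young ->
    src_vals (rf p) old srcs = Some vs ->
    find_bypass a old (sb p) = BypassHit res t ->
    p1 = set_rob p (old ++
      Entry k pc npc (Ld addr srcs dst (Some a) (Some res) (Some t)) Done :: young) ->
    ooo_rule pg i p [::] [::]
      (if (v != None) && (v != Some res) then flush k.+1 npc p1 else p1)
| OOO_LdReq old young k pc npc addr srcs dst a v vs :
    rob p = old ++ Entry k pc npc (Ld addr srcs dst (Some a) v None) Idle :: young ->
    src_vals (rf p) old srcs = Some vs ->
    find_bypass a old (sb p) = BypassNone ->
    ~~ lf p k ->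
    ooo_rule pg i p [:: ReqLd k a] [::]
      (set_rob p (old ++
         Entry k pc npc (Ld addr srcs dst (Some a) v None) Exe :: young))
| OOO_StEx old young k pc npc addr data srcs a0 v0 t vs a v :
    rob p = old ++ Entry k pc npc (St addr data srcs a0 v0 t) Idle :: young ->
    src_vals (rf p) old srcs = Some vs ->
    addr vs = a ->
    data vs = v ->
    ooo_rule pg i p [::] [::]
      (redo_lds (find_affected_ld a young)
         (set_rob p (old ++
            Entry k pc npc (St addr data srcs (Some a) (Some v) t) Done :: young)))
| OOO_NmCom young k pc npc op srcs dst v :
    rob p = Entry k pc npc (Nm op srcs dst (Some v)) Done :: young ->
    ooo_rule pg i p [::] [:: Event pc (RNm npc v)]
      (set_rf (set_rob p young) [eta rf p with dst |-> v])
| OOO_LdCom young k pc npc addr srcs dst a v t :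
    rob p = Entry k pc npc (Ld addr srcs dst (Some a) (Some v) t) Done :: young ->
    ooo_rule pg i p [::] [:: Event pc (RLd a v)]
      (set_rf (set_rob p young) [eta rf p with dst |-> v])
| OOO_RecCom young k pc npc :
    rob p = Entry k pc npc Reconcile Done :: young ->
    ooo_rule pg i p [::] [:: Event pc RReconcile] (set_rob p young)
| OOO_StCom young k pc npc addr data srcs a v t :
    rob p = Entry k pc npc (St addr data srcs (Some a) (Some v) t) Done :: young ->
    ooo_rule pg i p [::] [:: Event pc (RSt a v)]
      (set_sb (set_rob p young) (rcons (sb p) (SbEntry a v t false)))
| OOO_ComCom young k pc npc ex :
    rob p = Entry k pc npc Commit ex :: young ->
    sb p = [::] ->
    ooo_rule pg i p [::] [:: Event pc RCommit] (set_rob p young)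
| OOO_StReq s1 s2 a v t :
    sb p = s1 ++ SbEntry a v t false :: s2 ->
    a \notin [seq sb_addr x | x <- s1] ->
    ooo_rule pg i p [:: ReqSt a v t] [::]
      (set_sb p (s1 ++ SbEntry a v t true :: s2)).

Inductive resp_st (a : Addr) (p : oproc) : oproc -> Prop :=
| RespSt s1 s2 v t iss :
    sb p = s1 ++ SbEntry a v t iss :: s2 ->
    a \notin [seq sb_addr x | x <- s1] ->
    resp_st a p (set_sb p (s1 ++ s2)).

Inductive resp_ld (k : nat) (res : Val) (t : tag) (p : oproc) : oproc -> Prop :=
| RespLd_Flushed :
    lf p k ->
    resp_ld k res t p (set_lf p [eta lf p with k |-> false])
| RespLd_ReEx old young pc npc addr srcs dst a v t0 :
    ~~ lf p k ->
    rob p = old ++ Entry k pc npc (Ld addr srcs dst a v t0) ReEx :: young ->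
    resp_ld k res t p
      (set_rob p (old ++ Entry k pc npc (Ld addr srcs dst a v t0) Idle :: young))
| RespLd_Done old young pc npc addr srcs dst a v t0 ex p1 :
    ~~ lf p k ->
    rob p = old ++ Entry k pc npc (Ld addr srcs dst (Some a) v t0) ex :: young ->
    ex <> ReEx ->
    p1 = set_rob p (old ++
      Entry k pc npc (Ld addr srcs dst (Some a) (Some res) (Some t)) Done :: young) ->
    resp_ld k res t p
      (if (v != None) && (v != Some res) then flush k.+1 npc p1
       else if find_stale_ld a t young is Some e then flush (e_idx e) (e_pc e) p1
       else p1).

(* The unordered buffer [mrb i] is a list from which any element may be
   removed. *)
Record ooo_state := OooState {
  oprocs : 'I_n -> oproc;
  cmem : Addr -> Val * tag;
  mrb : 'I_n -> seq request }.

Inductive ooo_step (prog : 'I_n -> program) :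
  ooo_state -> trace -> ooo_state -> Prop :=
| OOO_Proc ps m rb i rq evs p' :
    ooo_rule (prog i) i (ps i) rq evs p' ->
    ooo_step prog (OooState ps m rb) [seq (i, ev) | ev <- evs]
      (OooState [eta ps with i |-> p'] m [eta rb with i |-> rb i ++ rq])
| CCM_Ld ps m rb i q1 q2 k a p' :
    rb i = q1 ++ ReqLd k a :: q2 ->
    resp_ld k (m a).1 (m a).2 (ps i) p' ->
    ooo_step prog (OooState ps m rb) [::]
      (OooState [eta ps with i |-> p'] m [eta rb with i |-> q1 ++ q2])
| CCM_St ps m rb i q1 q2 a v t p' :
    rb i = q1 ++ ReqSt a v t :: q2 ->
    resp_st a (ps i) p' ->
    ooo_step prog (OooState ps m rb) [::]
      (OooState [eta ps with i |-> p'] [eta m with a |-> (v, t)]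
                [eta rb with i |-> q1 ++ q2]).

Definition ooo_init (s0 : init_state) : ooo_state :=
  OooState
    (fun i => OProc (init_pc s0 i) (init_rf s0 i) [::] [::] (fun=> false) 0)
    (fun a => (init_mem s0 a, inl a))
    (fun=> [::]).

Definition ooo_behavior (prog : 'I_n -> program) (s0 : init_state) :
    behavior -> Prop :=
  has_behavior (ooo_step prog) (ooo_init s0)
    (fun s => forall i, sb (oprocs s i) = [::]) (fun s a => (cmem s a).1).

End Models.

(* Main.v *)
(* Label the steps of a WMM run, and let the time of a step be the number of
   earlier steps.  A load that misses the store buffer returns the value that
   memory had at some past time; since then its processor has executed no
   Reconcile, no store to that address and dequeued none, and the times of its
   loads of one address never decrease.  The out-of-order machine first fetches
   the whole future of the run, predicts every next PC and load value correctly
   and executes all Nm and St instructions.  It then replays the run: before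
   each step, every reorder buffer issues, oldest first, its loads whose time is
   the present one and gets their values at once; then the step itself is an
   in-order commit, or the issue of a store followed by its response.  The
   constraints on times say exactly that no older store or Reconcile
   interferes and that no younger load is stale, so nothing is ever flushed. *)

Require Import Defs.
From mathcomp Require Import all_boot.

Set Implicit Arguments.
Unset Strict Implicit.
Unset Printing Implicit Defensive.

Section Schedule.

Variables (Reg Addr Val PC : eqType) (n : nat).
Variables (prog : 'I_n -> program Reg Addr Val PC).
Variable (s0 : init_state Reg Addr Val PC n).

(** * Timed schedules: runs of WMM without invalidation buffers *)

(* [t] is the time at which memory held the value of a load, [None] if the
   value comes from the store buffer. *)
Inductive kind :=
| KNm (op : seq Val -> PC -> PC * Val) (srcs : seq Reg) (dst : Reg) (v : Val)
| KLd (addr : seq Val -> Addr) (srcs : seq Reg) (dst : Reg) (a : Addr) (v : Val)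
      (t : option nat)
| KSt (addr : seq Val -> Addr) (data : seq Val -> Val) (srcs : seq Reg)
      (a : Addr) (v : Val)
| KCommit
| KReconcile.

Record item := Item { it_pc : PC; it_npc : PC; it_kind : kind }.

Inductive label := LExec (i : 'I_n) (it : item) | LDeq (i : 'I_n) (a : Addr) (v : Val).

Definition it_event (it : item) : event Addr Val PC :=
  Event (it_pc it)
    match it_kind it with
    | KNm _ _ _ v => RNm Addr (it_npc it) v
    | KLd _ _ _ a v _ => RLd PC a v
    | KSt _ _ _ a v => RSt PC a v
    | KCommit => RCommit Addr Val PC
    | KReconcile => RReconcile Addr Val PC
    end.

Definition it_rf (rf : Reg -> Val) (it : item) : Reg -> Val :=
  match it_kind it with
  | KNm _ _ dst v | KLd _ _ dst _ v _ => [eta rf with dst |-> v]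
  | _ => rf
  end.

Definition it_st (it : item) : seq (Addr * Val) :=
  if it_kind it is KSt _ _ _ a v then [:: (a, v)] else [::].

(* A WMM state without its invalidation buffers. *)
Record core := Core {
  c_mem : Addr -> Val;
  c_pc : 'I_n -> PC;
  c_rf : 'I_n -> Reg -> Val;
  c_sb : 'I_n -> seq (Addr * Val) }.

(** For an enabled [LDeq], the first occurrence of the pair, which [rem] deletes, is the oldest
    store to [a]. *)
Definition apply (c : core) (l : label) : core :=
  match l with
  | LExec i it => Core (c_mem c)
      (fun j => if j == i then it_npc it else c_pc c j)
      (fun j => if j == i then it_rf (c_rf c i) it else c_rf c j)
      (fun j => if j == i then c_sb c i ++ it_st it else c_sb c j)
  | LDeq i a v => Core [eta c_mem c with a |-> v] (c_pc c) (c_rf c)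
      (fun j => if j == i then rem (a, v) (c_sb c i) else c_sb c j)
  end.

Definition run (ls : seq label) : core :=
  foldl apply (Core (init_mem s0) (init_pc s0) (init_rf s0) (fun=> [::])) ls.

Fixpoint items (i : 'I_n) (ls : seq label) : seq item :=
  match ls with
  | [::] => [::]
  | LExec j it :: ls' => if j == i then it :: items i ls' else items i ls'
  | _ :: ls' => items i ls'
  end.

Definition is_kst (a : Addr) (it : item) : bool :=
  if it_kind it is KSt _ _ _ a' _ then a' == a else false.

Definition is_krec (it : item) : bool :=
  if it_kind it is KReconcile then true else false.

(* After such a step, [i] can no longer read the earlier values of [a]. *)
Definition blocks (i : 'I_n) (a : Addr) (l : label) : bool :=
  match l with
  | LExec j it => (j == i) && (is_kst a it || is_krec it)
  | LDeq j b _ => (j == i) && (b == a)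
  end.

Definition kld_le (a : Addr) (t : nat) (it : item) : bool :=
  if it_kind it is KLd _ _ _ a' _ (Some t') then (a' == a) ==> (t' <= t) else true.

Definition ld_le (i : 'I_n) (a : Addr) (t : nat) (l : label) : bool :=
  if l is LExec j it then (j == i) ==> kld_le a t it else true.

(** The history takes the place of the invalidation buffer. [take t pre] is the run just before the
    step of time [t], so [t = size pre] is a read of the present memory. *)
Definition readable (pre : seq label) (i : 'I_n) (a : Addr) (v : Val) (t : nat) :=
  [&& t <= size pre, c_mem (run (take t pre)) a == v,
      ~~ has_addr a (c_sb (run pre) i), ~~ has (blocks i a) (drop t pre) &
      all (ld_le i a t) pre].

Definition local_ok (pg : program Reg Addr Val PC) (pc : PC) (rf : Reg -> Val)
    (it : item) : Prop :=
  it_pc it = pc /\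
  match it_kind it with
  | KNm op srcs dst v =>
      fetch pg pc = INm Addr op srcs dst /\ op [seq rf r | r <- srcs] pc = (it_npc it, v)
  | KLd addr srcs dst a v _ =>
      [/\ fetch pg pc = ILd PC addr srcs dst, it_npc it = succ_pc pg pc &
          addr [seq rf r | r <- srcs] = a]
  | KSt addr data srcs a v =>
      [/\ fetch pg pc = ISt PC addr data srcs, it_npc it = succ_pc pg pc,
          addr [seq rf r | r <- srcs] = a & data [seq rf r | r <- srcs] = v]
  | KCommit =>
      fetch pg pc = ICommit Reg Addr Val PC /\ it_npc it = succ_pc pg pc
  | KReconcile =>
      fetch pg pc = IReconcile Reg Addr Val PC /\ it_npc it = succ_pc pg pc
  end.

Definition oldest (a : Addr) (v : Val) (s : seq (Addr * Val)) : Prop :=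
  exists old young, s = old ++ (a, v) :: young /\ ~~ has_addr a old.

Definition youngest (a : Addr) (v : Val) (s : seq (Addr * Val)) : Prop :=
  exists old young, s = old ++ (a, v) :: young /\ ~~ has_addr a young.

Definition enabled (pre : seq label) (l : label) : Prop :=
  let c := run pre in
  match l with
  | LExec i it => local_ok (prog i) (c_pc c i) (c_rf c i) it /\
      match it_kind it with
      | KLd _ _ _ a v None => youngest a v (c_sb c i)
      | KLd _ _ _ a v (Some t) => readable pre i a v t
      | KCommit => c_sb c i = [::]
      | _ => True
      end
  | LDeq i a v => oldest a v (c_sb c i)
  end.

Fixpoint valid (pre post : seq label) : Prop :=
  if post is l :: post' then enabled pre l /\ valid (rcons pre l) post' else True.

Lemma valid_cat pre p1 p2 :
  valid pre (p1 ++ p2) <-> valid pre p1 /\ valid (pre ++ p1) p2.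
Proof.
elim: p1 pre => [|l p1 IH] pre /=; first by rewrite cats0; tauto.
by have := IH (rcons pre l); rewrite cat_rcons; tauto.
Qed.

Lemma valid_rcons ls l : valid [::] (rcons ls l) <-> valid [::] ls /\ enabled ls l.
Proof. by have := valid_cat [::] ls [:: l]; rewrite cats1 /=; tauto. Qed.

Lemma run_rcons ls l : run (rcons ls l) = apply (run ls) l.
Proof. exact: foldl_rcons. Qed.

Lemma items_cat i p1 p2 : items i (p1 ++ p2) = items i p1 ++ items i p2.
Proof. by elim: p1 => //= -[j it|j a v] p1 -> //; case: ifP. Qed.

Lemma has_addr_cat (a : Addr) (s1 s2 : seq (Addr * Val)) :
  has_addr a (s1 ++ s2) = has_addr a s1 || has_addr a s2.
Proof. by rewrite /has_addr /unzip1 map_cat mem_cat. Qed.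

Lemma has_addr_rem (a b : Addr) (v : Val) s :
  b != a -> has_addr a (rem (b, v) s) = has_addr a s.
Proof.
move=> ba; elim: s => //= -[b' v'] s; rewrite /has_addr /= xpair_eqE.
case: ifP => [/andP[/eqP -> _] _|_ /= IH]; last by rewrite !inE IH.
by rewrite inE eq_sym (negPf ba).
Qed.

Lemma rem_oldest (a : Addr) (v : Val) old young :
  ~~ has_addr a old -> rem (a, v) (old ++ (a, v) :: young) = old ++ young.
Proof.
elim: old => [|[b w] old IH] /=; first by rewrite eqxx.
rewrite /has_addr /= inE negb_or => /andP[ab ao].
by rewrite xpair_eqE eq_sym (negPf ab) /= IH.
Qed.

Lemma has_addr_apply i a c l :
  ~~ blocks i a l -> has_addr a (c_sb (apply c l) i) = has_addr a (c_sb c i).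
Proof.
case: l => [j it|j b v] /=; rewrite [i == j]eq_sym; have [->|//] := eqVneq j i;
  last exact: has_addr_rem.
rewrite has_addr_cat negb_or => /andP[Nst _].
suff /negPf->: ~~ has_addr a (it_st it) by rewrite orbF.
move: Nst; rewrite /is_kst /it_st /has_addr.
by case: (it_kind it) => //= _ _ _ b w; rewrite inE eq_sym.
Qed.

(** Only a store to [a] or a dequeue of [a] could change the presence of [a], and both block. Thus a
    store buffer miss when a load executes is also a miss at the earlier time at which it reads. *)
Lemma has_addr_run i a pre mid :
  ~~ has (blocks i a) mid ->
  has_addr a (c_sb (run (pre ++ mid)) i) = has_addr a (c_sb (run pre) i).
Proof.
elim/last_ind: mid => [|mid l IH]; first by rewrite cats0.
rewrite has_rcons negb_or -rcons_cat run_rcons => /andP[bl bm].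
by rewrite has_addr_apply // IH.
Qed.

Lemma readable_rcons pre l i a v t :
  readable pre i a v t -> ~~ blocks i a l -> ld_le i a t l ->
  readable (rcons pre l) i a v t.
Proof.
case/and5P=> tp mv sbN bN le bl lel; apply/and5P; split.
- by rewrite size_rcons ltnW.
- by rewrite -cats1 takel_cat.
- by rewrite run_rcons has_addr_apply.
- by rewrite drop_rcons // has_rcons negb_or bl.
- by rewrite all_rcons lel.
Qed.

(** * From WMM executions to schedules *)

Definition lds_past (pre : seq label) : Prop :=
  forall i a t, size pre <= t -> all (ld_le i a t) pre.

Lemma readable_now pre i a :
  lds_past pre -> ~~ has_addr a (c_sb (run pre) i) ->
  readable pre i a (c_mem (run pre) a) (size pre).
Proof.
move=> lp sbN; apply/and5P; split=> //; first by rewrite take_size.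
  by rewrite drop_size.
exact: lp.
Qed.

Definition stamped (pre : seq label) (i : 'I_n) (x : Addr * Val * nat) : bool :=
  (x.2 < size pre) && readable pre i x.1.1 x.1.2 x.2.

(** The stamp of an entry will be the time of the dequeue that overwrote its value, so insertion
    order is the order of time. Reading an entry purges the older ones for its address, which keeps
    load times from decreasing. *)
Definition ib_inv (pre : seq label) (i : 'I_n) (ib : seq (Addr * Val)) : Prop :=
  exists T : seq (Addr * Val * nat),
    [/\ unzip1 T = ib, sorted (relpre snd ltn) T & all (stamped pre i) T].

Lemma stamped_rcons pre l i T :
  all (stamped pre i) T ->
  all (fun x => ~~ blocks i x.1.1 l && ld_le i x.1.1 x.2 l) T ->
  all (stamped (rcons pre l) i) T.
Proof.
move=> T1 T2; have /allP T12: all (predI (stamped pre i)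
    (fun x => ~~ blocks i x.1.1 l && ld_le i x.1.1 x.2 l)) T by rewrite all_predI T1.
apply/allP=> x /T12 /= /andP[/andP[lt rd] /andP[bl le]].
by rewrite /stamped size_rcons ltnW //= readable_rcons.
Qed.

Lemma ib_inv_keep pre l i ib :
  ib_inv pre i ib -> (forall a t, ~~ blocks i a l && ld_le i a t l) ->
  ib_inv (rcons pre l) i ib.
Proof.
move=> [T [Ti Ts Tp]] H; exists T; split=> //; apply: stamped_rcons => //.
exact/allP.
Qed.

Lemma ib_inv_drop pre l i a ib :
  ib_inv pre i ib -> (forall b t, b != a -> ~~ blocks i b l && ld_le i b t l) ->
  ib_inv (rcons pre l) i (drop_addr a ib).
Proof.
move=> [T [Ti Ts Tp]] H; exists [seq x <- T | x.1.1 != a]; split.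
- by rewrite -Ti /drop_addr /unzip1 filter_map.
- by apply: sorted_filter => // x y z; apply: ltn_trans.
apply: stamped_rcons.
  by apply/allP=> x; rewrite mem_filter => /andP[_ xT]; apply: (allP Tp).
by apply/allP=> x; rewrite mem_filter => /andP[xa _]; apply: H.
Qed.

Definition matches (pre : seq label) (s : wmm_state Reg Addr Val PC n) : Prop :=
  [/\ wmem s = c_mem (run pre), lds_past pre &
      forall i, exists2 ib, wprocs s i = WProc (c_pc (run pre) i) (c_rf (run pre) i)
                                            (c_sb (run pre) i) ib
                          & ib_inv pre i ib].

Lemma unzip1_split (A B : Type) (T : seq (A * B)) x old young :
  unzip1 T = old ++ x :: young ->
  exists T1 t T2, [/\ T = T1 ++ (x, t) :: T2, unzip1 T1 = old & unzip1 T2 = young].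
Proof.
elim: old T => [|y old IH] [|[y' t] T] //= [-> E].
  by exists [::], t, T.
by have [T1 [t' [T2 [-> <- <-]]]] := IH _ E; exists ((y, t) :: T1), t', T2.
Qed.

Definition past (now : nat) (l : label) : bool :=
  if l is LExec _ (Item _ _ (KLd _ _ _ _ _ (Some t))) then t <= now else true.

(** A load from memory is timed by the present, a load from the invalidation buffer by the stamp of
    the entry it reads. The entries that cease to be readable are among those that the WMM rule
    purges. *)
Lemma exec_label i m pre ib ev p' :
  m = c_mem (run pre) -> lds_past pre -> ib_inv pre i ib ->
  wmm_exec (prog i) m
    (WProc (c_pc (run pre) i) (c_rf (run pre) i) (c_sb (run pre) i) ib) ev p' ->
  exists it ib',
    [/\ ev = it_event it, enabled pre (LExec i it),
        p' = WProc (it_npc it) (it_rf (c_rf (run pre) i) it)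
                   (c_sb (run pre) i ++ it_st it) ib',
        ib_inv (rcons pre (LExec i it)) i ib' &
        past (size pre) (LExec i it)].
Proof.
move=> mE lp ibI; set pc0 := c_pc _ i; set rf0 := c_rf _ i; set sb0 := c_sb _ i.
move EW: (WProc pc0 rf0 sb0 ib) => w W.
case: W EW => [pc rf sb ib0 op srcs dst npc v F O
  |pc rf sb ib0 addr srcs dst a v old young F A S N
  |pc rf sb ib0 addr srcs dst a F A N|pc rf sb ib0 addr srcs dst a v old young F A N S
  |pc rf sb ib0 addr data srcs a v F A D|pc rf ib0 F|pc rf sb ib0 F] [Epc Erf Esb Eib]; subst.
- exists (Item pc0 npc (KNm op srcs dst v)), ib0; split=> //=.
  + by rewrite cats0.
  + by apply: ib_inv_keep => // a t; rewrite /= ?andbF ?implybT.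
- exists (Item pc0 (succ_pc (prog i) pc0)
    (KLd addr srcs dst (addr [seq rf0 r | r <- srcs]) v None)), ib0.
  split=> //=.
  + by split=> //; exists old, young.
  + by rewrite Esb cats0.
  + by apply: ib_inv_keep => // a t; rewrite /= ?andbF ?implybT.
- set a := addr _ in N *.
  exists (Item pc0 (succ_pc (prog i) pc0)
    (KLd addr srcs dst a (c_mem (run pre) a) (Some (size pre)))).
  exists (drop_addr a ib0); split=> //=.
  + by split=> //; apply: readable_now.
  + by rewrite cats0.
  (* The time of this load exceeds the stamps of the entries for [a], but these all disappear. *)
  + apply: ib_inv_drop => // b t ba.
    by rewrite /= /kld_le /= andbF [a == b]eq_sym (negPf ba) implybT.
- set a := addr _ in N ibI *; have [T [Ti Ts Tp]] := ibI.
  have [T1 [t [T2 [TE T1i T2i]]]] := unzip1_split Ti.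
  have /andP[lt rd]: stamped pre i (a, v, t).
    by move: Tp; rewrite TE all_cat /= => /and3P[].
  exists (Item pc0 (succ_pc (prog i) pc0) (KLd addr srcs dst a v (Some t))).
  exists (drop_addr a old ++ (a, v) :: young); split=> //=; last exact: ltnW.
  + by rewrite cats0.
  + have sub: subseq ([seq x <- T1 | x.1.1 != a] ++ (a, v, t) :: T2) T.
      by rewrite TE cat_subseq // filter_subseq.
    exists ([seq x <- T1 | x.1.1 != a] ++ (a, v, t) :: T2); split.
    * by rewrite /unzip1 map_cat /= -/(unzip1 T2) T2i -T1i /drop_addr filter_map.
    * by apply: subseq_sorted Ts => //; move=> x y z; apply: ltn_trans.
    apply: stamped_rcons; first by apply/allP=> x /(mem_subseq sub); apply: (allP Tp).
    set l := LExec i _; have H x : (x.1.1 == a) ==> (t <= x.2) ->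
        ~~ blocks i x.1.1 l && ld_le i x.1.1 x.2 l.
      by rewrite /= /kld_le /= andbF eqxx [a == _]eq_sym.
    apply/allP=> x; rewrite mem_cat mem_filter inE.
    (* Older entries that are kept have another address; the entry read and the younger ones have
       stamps at least [t]. *)
    case/or3P=> [/andP[xa _]|/eqP ->|xT2]; apply: H.
    * by rewrite (negPf xa).
    * by rewrite /= leqnn implybT.
    apply/implyP=> _.
    move: Ts; rewrite TE sorted_pairwise; last by move=> ? ? ?; apply: ltn_trans.
    by rewrite pairwise_cat /= => /and3P[_ _ /andP[/allP /(_ _ xT2) /ltnW]].
- exists (Item pc0 (succ_pc (prog i) pc0)
    (KSt addr data srcs (addr [seq rf0 r | r <- srcs]) (data [seq rf0 r | r <- srcs]))).
  exists (drop_addr (addr [seq rf0 r | r <- srcs]) ib0); split=> //=.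
  + by rewrite cats1.
  + by apply: ib_inv_drop => // b t ba; rewrite /= eqxx /is_kst /= orbF eq_sym ba.
- exists (Item pc0 (succ_pc (prog i) pc0) KCommit), ib0; split=> //=.
  + by rewrite -/sb0 Esb.
  + by apply: ib_inv_keep => // a t; rewrite /= ?andbF ?implybT.
- exists (Item pc0 (succ_pc (prog i) pc0) KReconcile), [::]; split=> //=.
  + by rewrite cats0.
  + by exists [::].
Qed.

Lemma lds_past_rcons pre l :
  lds_past pre ->
  past (size pre) l -> lds_past (rcons pre l).
Proof.
move=> lp lt i a t; rewrite size_rcons all_rcons => szt.
rewrite lp ?andbT; last exact: ltnW.
case: l lt => //= j [pc npc k]; rewrite /kld_le /=.
case: k => [????|ad srcs dst b v [t'|]|?????||] H; rewrite ?implybT //.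
by rewrite (leq_trans H (ltnW szt)) !implybT.
Qed.

Lemma schedule tr s :
  execution (wmm_step prog) (wmm_init s0) tr s ->
  exists ls, [/\ valid [::] ls, matches ls s &
                 forall i, proc_trace i tr = [seq it_event it | it <- items i ls]].
Proof.
elim=> [|tr0 s1 l s2 _ [ls [vls [mE lp pE] tE]] S].
  by exists [::]; split=> //; split=> // i; exists [::] => //; exists [::].
case: S mE pE => [m ps i ev p' W|m ps i pc rf ib a v old young psi N] /= mE pE.
- have [ib psi ibI] := pE i; rewrite psi in W.
  have [it [ib' [-> en -> ibI' lt]]] := exec_label mE lp ibI W.
  exists (rcons ls (LExec i it)); split; first exact/valid_rcons.
    split=> [||j]; first by rewrite run_rcons.
      exact: lds_past_rcons.
    rewrite run_rcons /=; have [->|ji] := eqVneq j i; first by exists ib'.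
    have [ibj -> ibjI] := pE j; exists ibj => //.
    by apply: ib_inv_keep => // b t; rewrite /= eq_sym (negPf ji).
  move=> j; rewrite /proc_trace filter_cat map_cat -[X in X ++ _]/(proc_trace j tr0) tE.
  by rewrite -cats1 items_cat map_cat /=; case: eqP.
- have [ibi] := pE i; rewrite psi => -[Epc Erf Esb Eib] ibI.
  exists (rcons ls (LDeq i a v)); split.
  + by apply/valid_rcons; split=> //; exists old, young.
  + split=> [||j] /=; first by rewrite run_rcons /= mE.
      exact: lds_past_rcons.
    rewrite run_rcons /=; have [->|ji] := eqVneq j i.
      exists ib; first by rewrite -Epc -Erf -Esb rem_oldest.
      subst ibi; have [T [Ti Ts Tp]] := ibI; exists T; split=> //.
      (* The dequeue blocks [a], but no stamped entry is for [a]: readability requires a store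
         buffer without [a], and the store to be dequeued is still there. *)
      apply: stamped_rcons => //; apply/allP=> x /(allP Tp) /andP[_ /and5P[_ _ + _ _]].
      rewrite /= eqxx andbT -Esb; apply: contraNneq => <-.
      by rewrite has_addr_cat /has_addr /= inE eqxx orbT.
    have [ibj -> ibjI] := pE j; rewrite /wmm_invalidate /=.
    have keep : forall b t, ~~ blocks j b (LDeq i a v) && ld_le j b t (LDeq i a v).
      by move=> b t; rewrite /= eq_sym (negPf ji).
    case: ifP => [_|/negbT aN]; first by exists ibj => //; apply: ib_inv_keep.
    exists (rcons ibj (a, m a)) => //; have [T [Ti Ts Tp]] := ibjI.
    (* The stamp [size ls] exceeds all earlier ones, and just before this dequeue memory still holds
       [m a]. *)
    exists (rcons T (a, m a, size ls)); split.
    * by rewrite /unzip1 map_rcons -Ti.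
    * move: Ts; rewrite !sorted_pairwise; try by move=> ? ? ?; apply: ltn_trans.
      rewrite -cats1 pairwise_cat /= => ->; rewrite allrel1r !andbT.
      by apply: sub_all Tp => x /andP[].
    rewrite all_rcons stamped_rcons //; last by apply/allP.
    have /andP[bl le] := keep a (size ls).
    by rewrite /stamped /= size_rcons ltnSn /= andbT mE readable_rcons // readable_now.
  + by move=> j; rewrite cats0 tE -cats1 items_cat /= cats0.
Qed.

(** * Moves of a single out-of-order processor *)

Notation proc := (oproc Reg Addr Val PC n).
Notation state := (ooo_state Reg Addr Val PC n).
Notation memory := (Addr -> Val * Defs.tag Addr n).

Definition reach (tr : trace Addr Val PC n) (o : state) : Prop :=
  execution (ooo_step prog) (ooo_init s0) tr o.

(** Requests are answered as soon as they are sent, so this holds between moves. *)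
Definition quiet (o : state) : Prop := forall i, mrb o i = [::].

(** Processors are compared pointwise, which avoids functional extensionality. *)
Definition replaced (i : 'I_n) (p : proc) (o o' : state) : Prop :=
  [/\ quiet o', cmem o' = cmem o &
      forall j, oprocs o' j = if j == i then p else oprocs o j].

(** Quantifying over all reachable quiet states with memory [m] makes a move local to processor [i],
    hence composable whatever the other processors do. *)
Definition moves (m : memory) (i : 'I_n) (p : proc) (evs : seq (event Addr Val PC))
    (p' : proc) : Prop :=
  forall tr o, reach tr o -> quiet o -> cmem o = m -> oprocs o i = p ->
  exists o', reach (tr ++ [seq (i, ev) | ev <- evs]) o' /\ replaced i p' o o'.

Lemma moves_rule m i p evs p' :
  ooo_rule (prog i) i p [::] evs p' -> moves m i p evs p'.
Proof.
move=> R tr [ps cm rb] H Q Em Ep; rewrite -Ep in R; simpl in *.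
exists (OooState [eta ps with i |-> p'] cm [eta rb with i |-> rb i ++ [::]]); split.
  by apply: (exec_step H); apply: OOO_Proc.
by split=> //= j /=; rewrite ?cats0; case: eqP => // ->; rewrite ?Q.
Qed.

Lemma moves_refl m i p : moves m i p [::] p.
Proof.
move=> tr o H Q _ Ep; exists o; rewrite cats0; split=> //; split=> // j.
by case: eqP => // ->.
Qed.

Lemma moves_trans m i p1 e1 p2 e2 p3 :
  moves m i p1 e1 p2 -> moves m i p2 e2 p3 -> moves m i p1 (e1 ++ e2) p3.
Proof.
move=> M1 M2 tr o H Q Em Ep; have [o1 [H1 [Q1 Em1 Ep1]]] := M1 _ _ H Q Em Ep.
have [||o2 [H2 [Q2 Em2 Ep2]]] := M2 _ _ H1 Q1; first by rewrite Em1.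
  by rewrite Ep1 eqxx.
exists o2; rewrite map_cat catA; split=> //; split=> //; first by rewrite Em2.
by move=> j; rewrite Ep2 Ep1; case: eqP.
Qed.

(** [OOO_LdReq] and [CCM_Ld] fire back to back. The response confirms the prediction [v] and no
    younger load is stale, so neither flush happens. *)
Lemma moves_ld m i p old young k pc npc addr srcs dst a v vs :
  rob p = old ++ Entry k pc npc (Ld PC addr srcs dst (Some a) (Some v) None) Idle :: young ->
  src_vals (rf p) old srcs = Some vs ->
  find_bypass a old (sb p) = BypassNone Addr Val n ->
  lf p k = false ->
  find_stale_ld a (m a).2 young = None ->
  (m a).1 = v ->
  moves m i p [::] (set_rob p (old ++
    Entry k pc npc (Ld PC addr srcs dst (Some a) (Some v) (Some (m a).2)) Done :: young)).
Proof.
move=> Er Es Eb El Est Ev tr [ps cm rb] H Q Em Ep; rewrite -Ep in Er Es Eb El *.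
simpl in *; subst p cm.
have R := OOO_LdReq (prog i) i Er Es Eb (negbT El).
set p1 := set_rob (ps i) _ in R.
have H1 := exec_step H (OOO_Proc m rb R); rewrite /= cats0 in H1.
have := @RespLd_Done _ _ _ _ _ k (m a).1 (m a).2 p1 old young pc npc addr srcs dst a
  (Some v) None Exe _ (negbT El) erefl ltac:(by []) erefl.
rewrite Ev eqxx andbF Est => R2.
have Eq : [eta rb with i |-> rb i ++ [:: ReqLd Val n k a]] i = [::] ++ ReqLd Val n k a :: [::].
  by rewrite /= eqxx (Q i : rb i = _).
have Ei : [eta ps with i |-> p1] i = p1 by rewrite /= eqxx.
rewrite -Ei -{1}Ev in R2.
have H2 := exec_step H1 (CCM_Ld prog Eq R2); rewrite cats0 in H2.
eexists; split; first by rewrite cats0; exact: H2.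
by split=> //= j; rewrite /= ?eqxx; case: eqP => // _; apply: Q.
Qed.

Lemma moves_all m (P Q : 'I_n -> proc -> Prop) tr o :
  (forall i p, P i p -> exists2 p', moves m i p [::] p' & Q i p') ->
  reach tr o -> quiet o -> cmem o = m -> (forall i, P i (oprocs o i)) ->
  exists o', [/\ reach tr o', quiet o', cmem o' = m & forall i, Q i (oprocs o' i)].
Proof.
move=> PQ H Qo Em HP.
(* The processors move one after another; those not yet treated still satisfy [P]. *)
suff [o' [H' Qo' Em' HQ]] : exists o', [/\ reach tr o', quiet o', cmem o' = m &
    forall i, if i \in enum 'I_n then Q i (oprocs o' i) else P i (oprocs o' i)].
  by exists o'; split=> // i; have := HQ i; rewrite mem_enum.
elim: (enum 'I_n) (enum_uniq 'I_n) => [|i s IH] /= => [_|/andP[iN us]].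
  by exists o; split.
have [o1 [H1 Q1 Em1 HQ]] := IH us.
have := HQ i; rewrite (negPf iN) => /PQ [p' M Qp'].
have [o2 [H2 [Q2 Em2 Ep2]]] := M _ _ H1 Q1 Em1 erefl; rewrite cats0 in H2.
exists o2; split=> //; first by rewrite Em2.
move=> j; rewrite inE Ep2; have [->//|ji] /= := eqVneq j i; exact: HQ.
Qed.

(** * Reorder buffers that hold the whole future *)

Definition slot : Type := item * option (Defs.tag Addr n).

(** All results, addresses and predictions are already final. Only a load can be pending, namely
    while its slot has no tag. *)
Definition mkent (i : 'I_n) (k : nat) (x : slot) : entry Reg Addr Val PC n :=
  let: (Item pc npc kd, st) := x in
  match kd with
  | KNm op srcs dst v => Entry k pc npc (Nm Addr n op srcs dst (Some v)) Done
  | KLd addr srcs dst a v _ =>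
      Entry k pc npc (Ld PC addr srcs dst (Some a) (Some v) st)
            (if st is Some _ then Done else Idle)
  | KSt addr data srcs a v =>
      Entry k pc npc (St PC addr data srcs (Some a) (Some v) (inr (i, k))) Done
  | KCommit => Entry k pc npc (Commit Reg Addr Val PC n) Done
  | KReconcile => Entry k pc npc (Reconcile Reg Addr Val PC n) Done
  end.

(** Indices are consecutive because nothing is ever flushed. *)
Fixpoint mkrob (i : 'I_n) (k : nat) (xs : seq slot) : seq (entry Reg Addr Val PC n) :=
  if xs is x :: xs' then mkent i k x :: mkrob i k.+1 xs' else [::].

Lemma mkrob_cat i k xs ys :
  mkrob i k (xs ++ ys) = mkrob i k xs ++ mkrob i (k + size xs) ys.
Proof.
elim: xs k => [|x xs IH] k /=; first by rewrite addn0.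
by rewrite IH addSnnS.
Qed.

(** Every writing entry carries its final value, a predicted one if it is a pending load, so a
    source never has to wait. *)
Lemma src_val_mkrob i k xs rf0 r :
  src_val rf0 (mkrob i k xs) r = Some (foldl it_rf rf0 (unzip1 xs) r).
Proof.
rewrite /src_val; elim: xs k rf0 => //= [[[pc npc kd] st] xs] IH k rf0; rewrite -(IH k.+1).
by congr foldl; case: kd => //= *; rewrite /it_rf /= eq_sym; case: eqP.
Qed.

Lemma src_vals_mkrob i k xs rf0 srcs :
  src_vals rf0 (mkrob i k xs) srcs = Some [seq foldl it_rf rf0 (unzip1 xs) r | r <- srcs].
Proof.
rewrite /src_vals (eq_map (src_val_mkrob i k xs rf0)).
rewrite all_map all_predT; congr Some.
by elim: srcs => //= r srcs ->.
Qed.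

Lemma find_bypass_sb a (old : seq (entry Reg Addr Val PC n)) s :
  all (fun e => ~~ is_reconcile e && ~~ is_st_to a e) old ->
  find_bypass a old s = bypass_sb a (rev s).
Proof.
rewrite /find_bypass -(all_rev _ old); elim: (rev old) => //= e es IH.
case/andP=> /andP[rN sN] /IH E; move: rN sN; rewrite /is_reconcile /is_st_to.
by case: (e_ins e) => //= ? ? ? [a'|] [v|] t //=; case: (e_ex e) => // _ /negPf ->.
Qed.

Lemma bypass_sb_none a (s : seq (sb_entry Addr Val n)) :
  a \notin map (@sb_addr Addr Val n) s -> bypass_sb a (rev s) = BypassNone Addr Val n.
Proof.
rewrite -mem_rev -map_rev; elim: (rev s) => //= x s' IH.
by rewrite inE negb_or eq_sym => /andP[/negPf -> /IH].
Qed.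

Lemma find_stale_none a t (es : seq (entry Reg Addr Val PC n)) :
  all (fun e => ~~ (is_ld_to a e && is_done e)) es -> find_stale_ld a t es = None.
Proof.
elim: es => //= e es IH /andP[/negPf H /IH ->]; case: ifP => // _.
by rewrite andbA H.
Qed.

(** * The invariant, and loads performed at their time *)

Definition status_ok (now : nat) (x : slot) : bool :=
  if it_kind x.1 is KLd _ _ _ _ _ t then
    isSome x.2 == (if t is Some t' then t' < now else false)
  else true.

Definition sb_pair (x : sb_entry Addr Val n) : Addr * Val := (sb_addr x, sb_val x).

(** Loads timed before [now] are done; later ones, and those served by the store buffer, are
    pending. The [lf] bits stay unset for lack of flushes, and no store stays issued because its
    response follows at once. *)
Definition in_sync (pre post : seq label) (now : nat) (i : 'I_n) (p : proc) : Prop :=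
  exists k xs, [/\ rob p = mkrob i k xs, unzip1 xs = items i post,
    all (status_ok now) xs, rf p = c_rf (run pre) i &
    [/\ forall j, lf p j = false, map sb_pair (sb p) = c_sb (run pre) i &
        all (fun x => ~~ sb_iss x) (sb p)]].

Lemma items_split i post its1 it its2 :
  items i post = its1 ++ it :: its2 ->
  exists mid rest, [/\ post = mid ++ LExec i it :: rest, items i mid = its1 &
                       items i rest = its2].
Proof.
elim: post its1 => [|[j it'|j a v] post IH] its1 /=; first by case: its1.
  case: (eqVneq j i) => [->|ji].
    case: its1 => [[-> <-]|it1 its1 [-> /IH[mid [rest [-> <- <-]]]]].
      by exists [::], post.
    by exists (LExec i it1 :: mid), rest; split=> //=; rewrite eqxx.
  move=> /IH[mid [rest [-> <- <-]]].
  by exists (LExec j it' :: mid), rest; split=> //=; rewrite (negPf ji).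
move=> /IH[mid [rest [-> <- <-]]].
by exists (LDeq j a v :: mid), rest.
Qed.

Lemma no_block_items i a mid :
  ~~ has (blocks i a) mid ->
  all (fun it => ~~ (is_kst a it || is_krec it)) (items i mid).
Proof.
elim: mid => //= -[j it|j b v] mid IH /=; rewrite negb_or => /andP[H1 /IH H2] //.
by case: eqP H1 => //= _ ->.
Qed.

Definition kld_ge (a : Addr) (t : nat) (it : item) : bool :=
  if it_kind it is KLd _ _ _ a' _ (Some t') then (a' == a) ==> (t <= t') else true.

(** By [readable], the time of each load bounds the times of the earlier loads of its address. The
    hypothesis on [pre] is stated for arbitrary such bounds so that it survives the induction. *)
Lemma later_loads i a t pre post :
  valid pre post -> (forall t', all (ld_le i a t') pre -> t <= t') ->
  all (kld_ge a t) (items i post).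
Proof.
elim: post pre => //= l post IH pre [en /IH {}IH] H.
have {}IH : all (kld_ge a t) (items i post).
  by apply: IH => t'; rewrite all_rcons => /andP[_ /H].
case: l en => //= j it [_ en]; case: eqP en => // -> en /=; rewrite IH andbT.
rewrite /kld_ge; case: (it_kind it) en => // ? ? ? b v [t'|] // /and5P[_ _ _ _ le].
by apply/implyP=> /eqP ab; apply: H; rewrite -ab.
Qed.

Lemma all_mkrob (P : pred (entry Reg Addr Val PC n)) (Q : pred slot) i k xs :
  (forall k x, Q x -> P (mkent i k x)) -> all Q xs -> all P (mkrob i k xs).
Proof. by move=> QP; elim: xs k => //= x xs IH k /andP[/QP -> /IH ->]. Qed.

(** All conditions of [moves_ld] come from the readability of the load at its later execution. Slots
    in [xs2] have the status of [now] because loads are issued oldest first. *)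
Lemma do_load pre post i m p k xs1 xs2 pc npc addr srcs dst a v :
  let now := size pre in
  let it := Item pc npc (KLd addr srcs dst a v (Some now)) in
  valid pre post -> (forall b, (m b).1 = c_mem (run pre) b) ->
  rob p = mkrob i k (xs1 ++ (it, None) :: xs2) ->
  unzip1 (xs1 ++ (it, None) :: xs2) = items i post ->
  all (status_ok now) xs2 ->
  (forall j, lf p j = false) -> map sb_pair (sb p) = c_sb (run pre) i ->
  moves m i p [::] (set_rob p (mkrob i k (xs1 ++ (it, Some (m a).2) :: xs2))).
Proof.
move=> now it V mE Er Ex ok2 El Es.
have := Ex; rewrite /unzip1 map_cat /= => /esym /items_split[mid [rest [Ep E1 E2]]].
(* The load executes after [pre ++ mid]. At time [size pre], readability there speaks of the present
   memory and of the absence of blocking steps in [mid]. *)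
move: V; rewrite Ep => /valid_cat[_ /= [[_ /and5P[_ + sbN nb _]] V2]].
rewrite take_size_cat // => /eqP mv.
move: nb sbN; rewrite drop_size_cat // => nb; rewrite has_addr_run // => sbN.
rewrite !mkrob_cat /= in Er *.
apply: moves_ld (Er) (src_vals_mkrob i k xs1 (rf p) srcs) _ (El _) _ _; last by rewrite mE.
(* The older entries are the items of [mid], so no store to [a] or Reconcile stops the search before
   [sb]. *)
- rewrite find_bypass_sb; last first.
    apply: (all_mkrob (Q := fun x => ~~ (is_kst a x.1 || is_krec x.1))).
      by move=> k' [[? ? kd] ?]; rewrite negb_or andbC; case: kd.
    by have := no_block_items nb; rewrite E1 all_map.
  apply: bypass_sb_none; apply: contra sbN; rewrite /has_addr -Es /unzip1 -map_comp.
  by congr (_ \in _).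
(* A younger load of [a] that is done would have a time below [now], whereas [later_loads] makes it
   at least [now]. *)
- apply: find_stale_none.
  apply: (all_mkrob (Q := fun x => status_ok now x && kld_ge a now x.1)).
    move=> k' [[pc' npc' kd] st]; rewrite /status_ok /kld_ge /is_ld_to /is_done.
    case: kd => //= _ _ _ b w t.
    case: st => [st|]; last by rewrite andbF.
    by case: t => [t|] //=; rewrite andbT [t < _]ltnNge; case: (b == a); case: leqP.
  have := later_loads (i := i) (a := a) (t := now) V2.
  rewrite E2 all_predI ok2 /= all_map; apply=> t'.
  by rewrite all_rcons /= eqxx /kld_le /= eqxx => /andP[].
Qed.

Lemma do_loads pre post i m p :
  valid pre post -> (forall b, (m b).1 = c_mem (run pre) b) ->
  in_sync pre post (size pre) i p ->
  exists2 p', moves m i p [::] p' & in_sync pre post (size pre).+1 i p'.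
Proof.
move=> V mE [k [xs [Er Ex ok Erf [El Es Ei]]]].
(* Scan from the oldest slot: the prefix [don] has the status of the next time, the rest still that
   of the present. *)
move: Er Ex; rewrite -[xs]/([::] ++ xs) => Er Ex.
have : all (status_ok (size pre).+1) [::] by [].
elim: xs [::] p ok Er Ex Erf El Es Ei => [|x xs IH] don p /= ok Er Ex Erf El Es Ei okd.
  rewrite cats0 in Er Ex; exists p; first exact: moves_refl.
  by exists k, don; split.
case/andP: ok => okx ok.
case E: (status_ok (size pre).+1 x).
  by have := IH (rcons don x) p ok; rewrite cat_rcons all_rcons E; apply.
case: x okx E Er Ex => -[pc npc []] //= addr srcs dst a v t st.
(* A slot whose status must change is a pending load of time exactly [size pre]. *)
rewrite /status_ok /=; case: t => [t|]; last by move=> ->.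
rewrite ltnS [t <= _]leq_eqVlt; have [->|_] := eqVneq t (size pre); last by move=> ->.
rewrite ltnn; case: st => //= _ _ Er Ex.
have M := do_load V mE Er Ex ok El Es.
set it := Item pc npc _ in Ex M.
have := IH (rcons don (it, Some (m a).2)) _ ok.
rewrite cat_rcons all_rcons okd => /(_ (set_rob p _) erefl).
have -> : unzip1 (don ++ (it, Some (m a).2) :: xs) = items i post.
  by rewrite -Ex /unzip1 !map_cat.
case/(_ erefl Erf El Es Ei)=> [|p' M' S]; first by rewrite /status_ok /= ltnSn.
by exists p' => //; apply: moves_trans M M'.
Qed.

(** * Fetching and executing the whole future *)

Fixpoint chain (pg : program Reg Addr Val PC) (pc : PC) (rf0 : Reg -> Val)
    (its : seq item) : Prop :=
  if its is it :: its' then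
    local_ok pg pc rf0 it /\ chain pg (it_npc it) (it_rf rf0 it) its'
  else True.

(** The PC and registers of [i] change only by its own instructions. *)
Lemma valid_chain i pre post :
  valid pre post ->
  chain (prog i) (c_pc (run pre) i) (c_rf (run pre) i) (items i post).
Proof.
elim: post pre => //= l post IH pre [en /IH]; rewrite run_rcons.
case: l en => [j it [ok _]|j a v _] //=; rewrite eq_sym.
by case: eqP ok => // <-.
Qed.

(** The next PC is predicted correctly, so [OOO_NmEx] flushes nothing; the entry is the youngest, so
    [OOO_StEx] affects no load. A load gets its final value by [OOO_LdPred]. *)
Lemma preload1 m i p xs it :
  rob p = mkrob i 0 xs -> nidx p = size xs ->
  local_ok (prog i) (pcr p) (foldl it_rf (rf p) (unzip1 xs)) it ->
  moves m i p [::] (OProc (it_npc it) (rf p) (mkrob i 0 (rcons xs (it, None)))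
                          (sb p) (lf p) (size xs).+1).
Proof.
case: p => pc rf0 rb s l k /= -> -> {rb k}.
have Esv := src_vals_mkrob i 0 xs rf0.
rewrite -cats1 mkrob_cat /= add0n; move: (mkrob i 0 xs) Esv => rb Esv.
case: it => pc' npc kd [/= ->] ok.
have [ins [F G]] : exists ins, fetch (prog i) pc = ins /\
    (~~ is_nm ins -> npc = succ_pc (prog i) pc).
  by exists (fetch (prog i) pc); split=> //; case: kd ok => [????|??????|?????||] [] // ->.
apply: (moves_trans (e1 := [::])).
  by apply: moves_rule; apply: (OOO_Fetch (p := OProc pc rf0 rb s l (size xs)) i F G).
rewrite /= -F -cats1; move: (size xs).+1 => k'.
case: kd ok => [op srcs dst v [-> O]|addr srcs dst a v t [-> _ <-]
  |addr data srcs a v [-> _ A D]|[-> _]|[-> _]] /=; try exact: moves_refl.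
- have := OOO_NmEx (prog i) i (p := OProc npc rf0 _ s l k') (k := size xs) (young := [::])
    (npc := npc) (dst := dst) (val0 := None) erefl (Esv _) O erefl.
  by rewrite eqxx /=; apply: moves_rule.
- apply: (moves_trans (e1 := [::])).
    by apply: moves_rule; apply: (OOO_LdPred (prog i) i v (p := OProc npc rf0 _ s l k') erefl).
  apply: moves_rule.
  by apply: (OOO_LdAddr (p := OProc npc rf0 _ s l k') (prog i) i erefl (Esv _)).
- apply: moves_rule.
  by apply: (OOO_StEx (p := OProc npc rf0 _ s l k') (young := [::]) (prog i) i erefl
    (Esv _) A D).
Qed.

Lemma preload i m its p xs :
  rob p = mkrob i 0 xs -> nidx p = size xs ->
  chain (prog i) (pcr p) (foldl it_rf (rf p) (unzip1 xs)) its ->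
  exists2 p', moves m i p [::] p' &
    [/\ rob p' = mkrob i 0 (xs ++ [seq (it, None) | it <- its]), rf p' = rf p,
        sb p' = sb p & lf p' = lf p].
Proof.
elim: its p xs => [|it its IH] p xs Er En /=.
  by exists p; [exact: moves_refl | rewrite cats0].
move=> [ok ch]; have M := preload1 (m := m) Er En ok.
have [||p' M' [E1 E2 E3 E4]] := IH (OProc (it_npc it) (rf p) _ (sb p) (lf p) (size xs).+1)
  (rcons xs (it, None)) erefl.
- by rewrite size_rcons.
- by rewrite /unzip1 map_rcons foldl_rcons.
exists p'; first exact: moves_trans M M'.
by rewrite E1 E2 E3 E4 cat_rcons.
Qed.

(** * Replaying the steps of the schedule *)

Lemma in_sync_eq pre post pre' post' now i p :
  items i post' = items i post -> c_rf (run pre') i = c_rf (run pre) i ->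
  c_sb (run pre') i = c_sb (run pre) i ->
  in_sync pre post now i p -> in_sync pre' post' now i p.
Proof. by rewrite /in_sync => -> -> ->. Qed.

Lemma bypass_sb_youngest a v (s : seq (sb_entry Addr Val n)) :
  youngest a v (map sb_pair s) -> exists t, bypass_sb a (rev s) = BypassHit v t.
Proof.
case=> old [young [E aN]]; rewrite -[s]revK map_rev in E *; move: (rev s) E => {}s.
move=> /(congr1 rev); rewrite !revK rev_cat rev_cons cat_rcons.
have {aN} : ~~ has_addr a (rev young) by rewrite /has_addr /unzip1 map_rev mem_rev.
elim: (rev young) s => [|[b w] y IH] [|[b' v' t iss] s] //= => [_ [-> -> _]|].
  by exists t; rewrite eqxx.
rewrite /has_addr /= inE negb_or => /andP[ab aN] [-> _ E].
by rewrite eq_sym (negPf ab); apply: IH E.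
Qed.

(** The entry is done, except for a load served by the store buffer: it bypasses now, at the commit
    slot, where [sb] agrees with that of WMM. *)
Lemma commit m pre post i it p :
  enabled pre (LExec i it) -> in_sync pre (LExec i it :: post) (size pre).+1 i p ->
  exists2 p', moves m i p [:: it_event it] p' &
    in_sync (rcons pre (LExec i it)) post (size pre).+1 i p'.
Proof.
move=> [_ en] [k [[|[it' st] xs] [Er /= Ex ok Erf [El Es Ei]]]]; move: Ex; rewrite eqxx //.
case=> ? Ex; subst it'; case/andP: ok => ok1 ok.
have sync p' : rob p' = mkrob i k.+1 xs -> rf p' = it_rf (c_rf (run pre) i) it ->
    lf p' = lf p -> map sb_pair (sb p') = c_sb (run pre) i ++ it_st it ->
    all (fun x => ~~ sb_iss x) (sb p') ->
    in_sync (rcons pre (LExec i it)) post (size pre).+1 i p'.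
  move=> Er' Erf' El' Es' Ei'; exists k.+1, xs; split=> //.
    by rewrite run_rcons /= eqxx.
  by split=> // [j|]; [rewrite El' | rewrite run_rcons /= eqxx].
case: it en Er sync ok1 => pc npc [op srcs dst v|addr srcs dst a v t
  |addr data srcs a v||] /= en Er sync ok1.
- exists (set_rf (set_rob p (mkrob i k.+1 xs)) [eta rf p with dst |-> v]).
    by apply: moves_rule; apply: (OOO_NmCom (prog i) i Er).
  by apply: sync; rewrite //= ?Erf ?cats0.
- have [p1 [M [t' E1] [F1 F2 F3]]] : exists p1, [/\ moves m i p [::] p1,
      exists t', rob p1 = Entry k pc npc (Ld PC addr srcs dst (Some a) (Some v) (Some t')) Done
                          :: mkrob i k.+1 xs &
      [/\ rf p1 = rf p, lf p1 = lf p & sb p1 = sb p]].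
    clear sync; move: ok1 Er; rewrite /status_ok /=; case: st => [st|] okst Er.
      by exists p; split; [exact: moves_refl | exists st |].
    (* A timed load has time at most [size pre] by [readable], so it cannot be pending. *)
    case: t en okst => [t /and5P[lt _ _ _ _]|en _]; first by rewrite ltnS lt.
    rewrite -Es in en; have [t' Eb] := bypass_sb_youngest en.
    have R := OOO_LdBypass (prog i) i (old := [::]) Er (src_vals_mkrob i 0 [::] _ _) Eb erefl.
    rewrite eqxx andbF in R.
    by eexists; split; [exact: (moves_rule R) | exists t' |].
  exists (set_rf (set_rob p1 (mkrob i k.+1 xs)) [eta rf p1 with dst |-> v]).
    apply: (moves_trans M (e2 := [:: _])).
    by apply: moves_rule; apply: (OOO_LdCom (prog i) i E1).
  by apply: sync; rewrite //= ?F1 ?F2 ?F3 ?Erf ?cats0.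
- exists (set_sb (set_rob p (mkrob i k.+1 xs))
    (rcons (sb p) (SbEntry a v (inr (i, k)) false))).
    by apply: moves_rule; apply: (OOO_StCom (prog i) i Er).
  by apply: sync; rewrite //= ?map_rcons ?all_rcons ?Es ?cats1.
- exists (set_rob p (mkrob i k.+1 xs)).
    apply: moves_rule; apply: (OOO_ComCom (prog i) i Er).
    by rewrite en in Es; case: (sb p) Es.
  by apply: sync; rewrite //= cats0.
- exists (set_rob p (mkrob i k.+1 xs)).
    by apply: moves_rule; apply: (OOO_RecCom (prog i) i Er).
  by apply: sync; rewrite //= cats0.
Qed.

(** [OOO_StReq] and [CCM_St] fire back to back. *)
Lemma dequeue tr o pre post i a v now :
  reach tr o -> quiet o -> oldest a v (c_sb (run pre) i) ->
  in_sync pre (LDeq i a v :: post) now i (oprocs o i) ->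
  exists p' t o', [/\ reach tr o', quiet o', cmem o' = [eta cmem o with a |-> (v, t)],
    forall j, oprocs o' j = if j == i then p' else oprocs o j &
    in_sync (rcons pre (LDeq i a v)) post now i p'].
Proof.
case: o => ps m rb H Q [old [young [Ec aN]]] [k [xs [Er Ex ok Erf [El Es Ei]]]].
have Q' j : rb j = [::] := Q j.
simpl in *; rewrite Ec in Es.
(* No entry of [sb] is issued, so this one has the flag [false] that [OOO_StReq] demands. *)
have [s1 [t [s2 [Esb E1 E2]]]] : exists s1 t s2,
    [/\ sb (ps i) = s1 ++ SbEntry a v t false :: s2,
    map sb_pair s1 = old & map sb_pair s2 = young].
  elim: (sb (ps i)) old {Ec aN} Es Ei => [|[b w t []] s IH] [|[b' w'] old] //= [-> -> E] Ei.
    by exists [::], t, s.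
  by have [s1 [t' [s2 [-> <- <-]]]] := IH _ E Ei; exists (SbEntry b' w' t false :: s1), t', s2.
have aN1 : a \notin [seq sb_addr x | x <- s1].
  by apply: contra aN; rewrite -E1 /has_addr /unzip1 -map_comp.
have H1 := exec_step H (OOO_Proc m rb (OOO_StReq (prog i) i Esb aN1)).
set p1 := set_sb _ _ in H1.
have Eq : [eta rb with i |-> rb i ++ [:: ReqSt a v t]] i = [::] ++ ReqSt a v t :: [::].
  by rewrite /= eqxx Q'.
have Ei1 : [eta ps with i |-> p1] i = p1 by rewrite /= eqxx.
have R2 : resp_st a ([eta ps with i |-> p1] i) (set_sb p1 (s1 ++ s2)).
  by rewrite Ei1; apply: (RespSt (p := p1) (v := v) (t := t) (iss := true) erefl aN1).
have H2 := exec_step H1 (CCM_St prog m Eq R2); rewrite !cats0 in H2.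
exists (set_sb p1 (s1 ++ s2)), t; eexists; split; first exact: H2.
- by move=> j /=; case: eqP.
- by [].
- by move=> j /=; case: eqP.
exists k, xs; split=> //; first by rewrite run_rcons.
split=> //; last by move: Ei; rewrite Esb !all_cat.
by rewrite run_rcons /= eqxx Ec rem_oldest // map_cat E1 E2.
Qed.

(** The future [post] is general because the first state already contains the whole run; the
    induction moves one label at a time from [post] to [pre]. *)
Lemma simulate pre post :
  valid [::] (pre ++ post) ->
  exists tr o, [/\ reach tr o, quiet o, forall a, (cmem o a).1 = c_mem (run pre) a,
    forall i, in_sync pre post (size pre) i (oprocs o i) &
    forall i, proc_trace i tr = [seq it_event it | it <- items i pre]].
Proof.
elim/last_ind: pre post => [|pre l IH] post V.
  (* At time 0 each processor preloads its part of the run; no load is timed before 0, so all are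
     pending. *)
  pose P i p := p = oprocs (ooo_init s0) i.
  have [|||||o [H Q Em Hs]] := @moves_all (cmem (ooo_init s0)) P
      (fun i => in_sync [::] post 0 i) [::] (ooo_init s0).
  - move=> i _ ->.
    have [|||p' M [E1 E2 E3 E4]] := @preload i (cmem (ooo_init s0)) (items i post)
        (oprocs (ooo_init s0) i) [::] => //.
      exact: valid_chain V.
    exists p' => //; exists 0, [seq (it, None) | it <- items i post]; split=> //.
    + by rewrite /unzip1 -map_comp map_id.
    + elim: (items i post) => //= -[pc npc kd] its ->.
      by rewrite /status_ok; case: kd => // ? ? ? ? ? [].
    + by rewrite E3 E4.
  - exact: exec_init.
  - by [].
  - by [].
  - by [].
  by exists [::], o; split=> // a; rewrite Em.
rewrite cat_rcons in V; have [tr [o [H Q Em Hs Et]]] := IH _ V.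
have [_ Vp] := (valid_cat _ _ _).1 V.
(* Loads timed [size pre] must read before the step [l] can change memory. *)
have [o1 [H1 Q1 Em1 Hs1]] := moves_all (fun i p => do_loads Vp Em) H Q erefl Hs.
have [en _] := Vp; rewrite size_rcons.
case: l V Vp en Hs Hs1 => [i it|i a v] V Vp en Hs Hs1.
- have [p' M Hs'] := commit (cmem o) en (Hs1 i).
  have [o2 [H2 [Q2 Em2 Ep2]]] := M _ _ H1 Q1 Em1 erefl.
  exists (tr ++ [:: (i, it_event it)]), o2; split=> //.
  + by move=> a; rewrite Em2 Em1 Em run_rcons.
  + move=> j; rewrite Ep2; case: (eqVneq j i) => [->//|ji].
    by apply: in_sync_eq (Hs1 j); rewrite ?run_rcons /= ?[i == j]eq_sym (negPf ji).
  + move=> j; rewrite /proc_trace filter_cat map_cat -[X in X ++ _]/(proc_trace j tr) Et.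
    by rewrite -cats1 items_cat map_cat /=; case: eqP.
- have [p' [t [o2 [H2 Q2 Em2 Ep2 Hs2]]]] := dequeue H1 Q1 en (Hs1 i).
  exists tr, o2; split=> //.
  + by move=> b; rewrite Em2 run_rcons /= Em1; case: eqP.
  + move=> j; rewrite Ep2; case: (eqVneq j i) => [->//|ji].
    by apply: in_sync_eq (Hs1 j); rewrite ?run_rcons /= ?(negPf ji).
  + by move=> j; rewrite Et -cats1 items_cat cats0.
Qed.

End Schedule.

Theorem theorem2 (Reg Addr Val PC : eqType) (n : nat)
    (prog : 'I_n -> program Reg Addr Val PC)
    (s0 : init_state Reg Addr Val PC n)
    (b : behavior Addr Val PC n) :
  wmm_behavior prog s0 b -> ooo_behavior prog s0 b.
Proof.
move=> [tr [s [/schedule[ls [V [mE _ pE] tE]] sbE bi bm]]].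
have [|tr' [o [H _ Em Hs Et]]] := @simulate _ _ _ _ _ prog s0 ls [::]; first by rewrite cats0.
exists tr', o; split=> // [i|i|a].
- have [k [xs [_ _ _ _ [_ Es _]]]] := Hs i.
  by have := sbE i; have [ib -> _] := pE i; rewrite /= -Es; case: (sb _).
- by rewrite Et -tE.
- by rewrite Em -mE.
Qed.
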